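(* Let $(X,* )$ be a shelf with a right fixed element, i.e. there exist $c,r\in X$ such that $x*r=c$ for all $x\in X$. Then the two-term (rack) homology of $X$ is $\mathbb{Z}$ in all dimensions: $H_n^R(X)\cong\mathbb{Z}$ for all $n\ge 0$.
   Context: A shelf is a set $X$ with a binary operation $*$ satisfying $(a*b)*c=(a*c)*(b*c)$ for all $a,b,c\in X$ (right self-distributivity). If $c,r\in X$ satisfy $x*r=c$ for all $x\in X$, then $r$ is called a right $c$-fixed element. Two-term (rack) homology of a shelf $(X,* )$: for $n\ge 0$ let $C_n=\mathbb{Z}X^{n+1}$ be the free abelian group on $(n+1)$-tuples $(x_0,\dots,x_n)$ of elements of $X$, with $C_{-1}=0$. For $n\ge1$ and $0\le i\le n$ put $d^{( *_0)}_{i,n}(x_0,\dots,x_n)=(x_0,\dots,x_{i-1},x_{i+1},\dots,x_n)$ and $d^{( * )}_{i,n}(x_0,\dots,x_n)=(x_0*x_i,\dots,x_{i-1}*x_i,x_{i+1},\dots,x_n)$ (so for $i=0$ both equal $(x_1,\dots,x_n)$), extended linearly. Let $d^R_{i,n}=d^{( *_0)}_{i,n}-d^{( * )}_{i,n}$ and $\partial^R_n=\sum_{i=0}^n(-1)^i d^R_{i,n}:C_n\to C_{n-1}$ (and $\partial^R_0=0$). Then $(C_n,\partial^R_n)$ is a chain complex and $H_n^R(X)=\ker(\partial^R_n)/\mathrm{im}(\partial^R_{n+1})$. *)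

(* Defs.v *)
From HB Require Import structures.
From mathcomp Require Import all_boot ssralg ssrint ring_quotient boolp.
From mathcomp Require Import freeg.

Set Implicit Arguments.
Unset Strict Implicit.
Unset Printing Implicit Defensive.

Import GRing.Theory.
Local Open Scope ring_scope.

Definition shelf (X : Type) (op : X -> X -> X) : Prop :=
  forall a b c, op (op a b) c = op (op a c) (op b c).

Definition right_fixed (X : Type) (op : X -> X -> X) (c r : X) : Prop :=
  forall x, op x r = c.

(* The operation [*_0]. *)
Definition op0 (X : Type) (x y : X) : X := x.

(* (x_0, ..., x_n) |-> (x_0 * x_i, ..., x_{i-1} * x_i, x_{i+1}, ..., x_n);
   for [op0] this merely deletes x_i.  [lift i] skips the index i. *)
Definition face_tuple (X : Type) (op : X -> X -> X) (n : nat) (i : 'I_n.+1)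
    (x : n.+1.-tuple X) : n.-tuple X :=
  [tuple let y := tnth x (fintype.lift i j) in
         if (j < i)%N then op y (tnth x i) else y | j < n].

Section RackHomology.

Variables (X : choiceType) (op : X -> X -> X).

Definition chain (n : nat) : zmodType := {freeg (n.+1.-tuple X) / int}.

Definition face (o : X -> X -> X) (n : nat) (i : 'I_n.+2) :
    chain n.+1 -> chain n :=
  fglift (fun x => << face_tuple o i x >>).

Definition faceR (n : nat) (i : 'I_n.+2) (u : chain n.+1) : chain n :=
  face (@op0 X) i u - face op i u.

(* The differential from degree n + 1 to degree n. *)
Definition boundary (n : nat) (u : chain n.+1) : chain n :=
  \sum_(i < n.+2) faceR i u *~ (-1) ^+ i.

Fact boundary_is_zmod_morphism n : zmod_morphism (@boundary n).
Proof.
move=> u v; rewrite /boundary -sumrB; apply: eq_bigr => i _.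
rewrite -mulrzBl /faceR /face !lift_is_additive.
by rewrite opprD addrACA -opprD.
Qed.

HB.instance Definition _ n :=
  GRing.isZmodMorphism.Build (chain n.+1) (chain n) (@boundary n)
    (@boundary_is_zmod_morphism n).

(* As C_{-1} = 0, every chain of degree 0 is a cycle. *)
Definition is_cycle (n : nat) : {pred chain n} :=
  match n with
  | 0 => fun=> true
  | m.+1 => fun u => boundary u == 0
  end.

Fact is_cycle_closed n : zmod_closed (@is_cycle n).
Proof.
case: n => [|n] //; split=> [|u v]; rewrite !unfold_in /= ?raddf0 //.
by move=> /eqP u0 /eqP v0; rewrite raddfB /= u0 v0 subr0.
Qed.

HB.instance Definition _ n :=
  GRing.isZmodClosed.Build (chain n) (@is_cycle n) (@is_cycle_closed n).

Definition cycles (n : nat) := {u : chain n | is_cycle u}.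

HB.instance Definition _ n := SubChoice.on (cycles n).
HB.instance Definition _ n := [SubChoice_isSubZmodule of cycles n by <:].

(* Im(boundary) is taken inside the group of cycles; for a shelf it lies there,
   as the differential squares to zero. *)
Definition is_boundary (n : nat) : {pred cycles n} :=
  fun z => `[< exists v : chain n.+1, boundary v = val z >].

Fact is_boundary_closed n : zmod_closed (@is_boundary n).
Proof.
split=> [|y z]; first by apply/asboolP; exists 0; rewrite !raddf0.
move=> /asboolP[u Eu] /asboolP[v Ev]; apply/asboolP; exists (u - v).
by rewrite !raddfB /= Eu Ev.
Qed.

HB.instance Definition _ n :=
  GRing.isZmodClosed.Build (cycles n) (@is_boundary n) (@is_boundary_closed n).

Definition homology (n : nat) : zmodType := {ideal_quot (@is_boundary n)}.

End RackHomology.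

(* Main.v *)
Require Import Defs.
From HB Require Import structures.
From mathcomp Require Import all_boot ssralg ssrint ring_quotient boolp.
From mathcomp Require Import freeg.

(** Appending the fixed element [r] to tuples, x |-> (x, r), is a contracting
    homotopy up to constants.  Each face of (x, r) other than the last one is
    the corresponding face of x with [r] appended, while the two last faces of
    (x, r) are x itself and the constant tuple (c, ..., c), because y * r = c
    for every y.  Hence, for a chain u of degree n,
    [boundary (cone r u)] is the sum of [cone r (boundary u)] and of
    (-1)^(n+1) (u - deg(u) (c, ..., c)), where deg is the sum of the coefficients
    ([boundary_cone], stated for cycles, where the first summand vanishes).

    A cycle u with deg(u) = 0 is therefore a boundary.  Conversely deg
    vanishes on boundaries, since each generator is sent to differences of generators
    ([deg_boundary]).  So deg induces an injective map from homology to the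
    integers, and it is onto because (c, ..., c) is a cycle
    ([const_chain_cycle]).  Self-distributivity enters only there: it gives
    c * c = c ([right_fixed_idem]), so that all faces of (c, ..., c) agree. *)

Set Implicit Arguments.
Unset Strict Implicit.
Unset Printing Implicit Defensive.

Import GRing.Theory.
Local Open Scope ring_scope.
Local Open Scope quotient_scope.

(** Additive maps out of a free abelian group are determined by the generators. *)
Lemma freeg_zmod_morphism_ext (K : choiceType) (V : zmodType)
    (f g : {freeg K / int} -> V) :
    zmod_morphism f -> zmod_morphism g ->
  (forall x, f << x >> = g << x >>) -> f =1 g.
Proof.
move=> fB gB fg u.
pose fM := GRing.isZmodMorphism.Build _ _ f fB.
pose gM := GRing.isZmodMorphism.Build _ _ g gB.
pose fA : {additive _ -> _} := HB.pack f fM.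
pose gA : {additive _ -> _} := HB.pack g gM.
rewrite -[f]/(fA : _ -> _) -[g]/(gA : _ -> _) -(freeg_sumE u) !raddf_sum.
apply: eq_bigr => x _; rewrite -[coeff x u]intz -freegU_mulz.
by rewrite !raddfMz /= fg.
Qed.

Section Faces.

(* The lemmas are stated for an arbitrary [o], to cover [op] and [op0] alike. *)

Variables (X : Type) (o : X -> X -> X).

Lemma face_tuple_rcons n (i : 'I_n.+1) (x : n.+1.-tuple X) (r : X) :
  face_tuple o (widen_ord (leqnSn _) i) [tuple of rcons x r] =
  [tuple of rcons (face_tuple o i x) r].
Proof.
apply: eq_from_tnth => j; rewrite tnth_mktuple !(tnth_nth r) /=.
rewrite !nth_rcons !size_tuple card_ord (ltn_ord i).
(* The last entry j = n is not an index of [face_tuple o i x]: there the face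
   returns the appended [r], which comes after x_i and so is left unchanged. *)
have [lt_jn | le_nj] := ltnP j n.
  have /= -> := esym (tnth_nth r (face_tuple o i x) (Ordinal lt_jn)).
  rewrite tnth_mktuple !(tnth_nth r) /=.
  have -> : (bump i j < n.+1)%N := ltn_ord (fintype.lift i (Ordinal lt_jn)).
  by [].
have -> : j = n :> nat by apply/eqP; rewrite eqn_leq le_nj -ltnS ltn_ord.
have le_in : (i <= n)%N by rewrite -ltnS ltn_ord.
by rewrite /bump le_in add1n ltnn eqxx ltnNge le_in eqxx.
Qed.

Lemma face_tuple_rcons_max n (x : n.-tuple X) (r : X) :
  face_tuple o ord_max [tuple of rcons x r] = [tuple of map (o^~ r) x].
Proof.
apply: eq_from_tnth => j; rewrite tnth_mktuple tnth_map !(tnth_nth r) /=.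
have lt_jn := ltn_ord j.
by rewrite !nth_rcons size_tuple ltnn eqxx /bump (leqNgt n)
  lt_jn /= add0n lt_jn.
Qed.

Lemma face_tuple0 (o' : X -> X -> X) n (x : n.+1.-tuple X) :
  face_tuple o ord0 x = face_tuple o' ord0 x.
Proof. by apply: eq_from_tnth => j; rewrite !tnth_mktuple. Qed.

Lemma face_tuple_nseq n (i : 'I_n.+1) (c : X) :
  o c c = c -> face_tuple o i (nseq_tuple n.+1 c) = nseq_tuple n c.
Proof.
move=> occ; have nthc m (j : 'I_m) : tnth (nseq_tuple m c) j = c.
  by rewrite (tnth_nth c) nth_nseq ltn_ord.
by apply: eq_from_tnth => j; rewrite tnth_mktuple /= !nthc occ if_same.
Qed.

End Faces.

Section Cone.

Variables (X : choiceType) (op : X -> X -> X).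

Lemma face_is_zmod_morphism (o : X -> X -> X) n (i : 'I_n.+2) :
  zmod_morphism (@face X o n i).
Proof. exact: lift_is_additive. Qed.

Lemma faceU (o : X -> X -> X) n (i : 'I_n.+2) (x : n.+2.-tuple X) :
  face o i << x >> = << face_tuple o i x >>.
Proof. by rewrite /face liftU scale1r. Qed.

Lemma faceR_is_zmod_morphism n (i : 'I_n.+2) : zmod_morphism (@faceR X op n i).
Proof.
by move=> u v; rewrite /faceR !face_is_zmod_morphism opprD addrACA -opprD.
Qed.

Lemma faceRU n (i : 'I_n.+2) (x : n.+2.-tuple X) :
  faceR op i << x >> = << face_tuple (@op0 X) i x >> - << face_tuple op i x >>.
Proof. by rewrite /faceR !faceU. Qed.

(** Nothing precedes the entry 0, so both of its faces merely delete it. *)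
Lemma faceR0 n (u : chain X n.+1) : faceR op ord0 u = 0.
Proof.
apply: (freeg_zmod_morphism_ext (@faceR_is_zmod_morphism n ord0) (g := fun=> 0)).
  by move=> ? ?; rewrite subrr.
by move=> x; rewrite faceRU (face_tuple0 (@op0 X) op) subrr.
Qed.

Lemma deg_faceR n (i : 'I_n.+2) (u : chain X n.+1) : deg (faceR op i u) = 0.
Proof.
apply: (@freeg_zmod_morphism_ext _ _ (fun u => deg (faceR op i u)) (fun=> 0)).
- by move=> v w; rewrite faceR_is_zmod_morphism degB.
- by move=> ? ?; rewrite subrr.
- by move=> x; rewrite faceRU degB !degU subrr.
Qed.

Lemma deg_boundary n (u : chain X n.+1) : deg (boundary op u) = 0.
Proof.
rewrite /boundary raddf_sum big1 // => i _.
by rewrite /= raddfMz /= deg_faceR mul0rz.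
Qed.

(** The homotopy operator (x_0, ..., x_n) |-> (x_0, ..., x_n, r). *)
Definition cone (r : X) n : chain X n -> chain X n.+1 :=
  fglift (fun x : n.+1.-tuple X => << [tuple of rcons x r] >>).

Lemma cone_is_zmod_morphism r n : zmod_morphism (@cone r n).
Proof. exact: lift_is_additive. Qed.

HB.instance Definition _ r n :=
  GRing.isZmodMorphism.Build (chain X n) (chain X n.+1) (@cone r n)
    (@cone_is_zmod_morphism r n).

Lemma coneU r n (x : n.+1.-tuple X) :
  cone r << x >> = << [tuple of rcons x r] >>.
Proof. by rewrite /cone liftU scale1r. Qed.

Lemma faceR_cone r n (i : 'I_n.+2) (u : chain X n.+1) :
  faceR op (widen_ord (leqnSn _) i) (cone r u) = cone r (faceR op i u).
Proof.
apply: (@freeg_zmod_morphism_ext _ _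
  (fun u => faceR op (widen_ord _ i) (cone r u))
  (fun u => cone r (faceR op i u))) => [v w | v w | x].
- by rewrite raddfB faceR_is_zmod_morphism.
- by rewrite faceR_is_zmod_morphism raddfB.
- by rewrite coneU !faceRU raddfB /= !coneU !face_tuple_rcons.
Qed.

(** The generator (c, ..., c) of degree n, with n + 1 entries. *)
Definition const_chain (c : X) n : chain X n := << nseq_tuple n.+1 c >>.

(** The last face of the cone is where the right fixed element is used: [op0]
    gives back u, and [op] collapses every tuple to (c, ..., c). *)
Lemma faceR_cone_max c r n (u : chain X n) : right_fixed op c r ->
  faceR op ord_max (cone r u) = u - const_chain c n *~ deg u.
Proof.
move=> fixed_r; apply: (@freeg_zmod_morphism_ext _ _
  (fun u => faceR op ord_max (cone r u))
  (fun u => u - const_chain c n *~ deg u)) => [v w | v w | x].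
- by rewrite raddfB faceR_is_zmod_morphism.
- by rewrite degB mulrzBr opprD addrACA -opprD.
rewrite coneU faceRU !face_tuple_rcons_max degU mulr1z.
congr (<< _ >> - << _ >>); apply: eq_from_tnth => j; rewrite tnth_map //.
by rewrite fixed_r (tnth_nth c) nth_nseq ltn_ord.
Qed.

(** The homotopy formula on cycles. *)
Lemma boundary_cone c r n (u : chain X n) : right_fixed op c r ->
  is_cycle op u ->
  boundary op (cone r u) = (u - const_chain c n *~ deg u) *~ (-1) ^+ n.+1.
Proof.
move=> fixed_r u_cycle; rewrite /boundary big_ord_recr /=.
rewrite (faceR_cone_max _ fixed_r) [X in X + _](_ : _ = 0) ?add0r //.
(* For n = 0 there is no boundary below to compare with; the only remaining face
   has index 0 and vanishes. *)
case: n u u_cycle => [|n] u u_cycle.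
  rewrite big_ord1 [widen_ord _ _](_ : _ = ord0) ?faceR0 ?mul0rz //.
  exact: val_inj.
rewrite -[RHS](raddf0 (@cone r n)) -(eqP u_cycle) raddf_sum.
by apply: eq_bigr => i _; rewrite faceR_cone raddfMz.
Qed.

Lemma const_chain_cycle c n : op c c = c -> is_cycle op (const_chain c n).
Proof.
move=> occ; case: n => //= n; apply/eqP.
rewrite /boundary big1 // => i _.
by rewrite faceRU !face_tuple_nseq // subrr mul0rz.
Qed.

End Cone.

(** c * c = (x * r) * (y * r) = (x * y) * r = c, with x = y = c. *)
Lemma right_fixed_idem (X : Type) (op : X -> X -> X) (c r : X) :
  shelf op -> right_fixed op c r -> op c c = c.
Proof. by move=> sh fx; rewrite -[in LHS](fx c) -{1}(fx c) -sh fx. Qed.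

Section HomologyDegree.

Variables (X : choiceType) (op : X -> X -> X) (n : nat).

(** The homology class of a cycle. *)
Definition homology_class : cycles op n -> homology op n := \pi_(homology op n).

(** The sum of coefficients of a homology class, read off a chosen
    representative; [homology_degE] shows that the choice is irrelevant. *)
Definition homology_deg (q : homology op n) : int := deg (val (repr q)).

Lemma homology_class_eqP (y z : cycles op n) :
  reflect (exists v, boundary op v = val y - val z)
          (homology_class y == homology_class z).
Proof.
rewrite /homology_class -Quotient.idealrBE -raddfB; exact: asboolP.
Qed.

Lemma homology_degE (z : cycles op n) :
  homology_deg (homology_class z) = deg (val z).
Proof.
have /homology_class_eqP[v Ev] :
    homology_class (repr (homology_class z)) == homology_class z.
  by rewrite /homology_class reprK.
by apply/eqP; rewrite -subr_eq0 -degB -Ev deg_boundary.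
Qed.

Lemma homology_deg_is_zmod_morphism : zmod_morphism homology_deg.
Proof.
elim/quotW=> y; elim/quotW=> z.
rewrite -raddfB -/homology_class.
by rewrite !homology_degE -degB -raddfB.
Qed.

HB.instance Definition _ :=
  GRing.isZmodMorphism.Build (homology op n) int homology_deg
    homology_deg_is_zmod_morphism.

End HomologyDegree.

Theorem theorem3p3 (X : choiceType) (op : X -> X -> X) (c r : X)
    (shelf_op : shelf op) (fixed_r : right_fixed op c r) (n : nat) :
  exists f : {additive homology op n -> int}, bijective f.
Proof.
have c_cycle := const_chain_cycle n (right_fixed_idem shelf_op fixed_r).
pose zc : cycles op n := Sub (const_chain c n) c_cycle.
exists (@homology_deg X op n).
exists (fun k => homology_class (zc *~ k)) => [|k]; last first.
  by rewrite /= homology_degE raddfMz raddfMz /= degU intz.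
elim/quotW => z; rewrite -/(homology_class z) /= homology_degE.
apply/eqP; rewrite eq_sym; apply/homology_class_eqP.
(* The sign cancels the one in the homotopy formula. *)
exists (cone r (val z) *~ (-1) ^+ n.+1).
rewrite raddfMz /= (boundary_cone fixed_r (valP z)) -mulrzA -expr2 sqrr_sign.
by rewrite mulr1z [val (zc *~ _)]raddfMz.
Qed.
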